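(* If $\Omega=\{\omega_1,\ldots,\omega_M\}$ is an LF-inducing set, then the infinite (one-sided) Mahavier product $I_{F_\Omega}^+$ is a Lelek fan.
   Context: $I=[0,1]$. For a closed relation $F\subseteq X\times X$ on a compact metric space $X$, the infinite (one-sided) Mahavier product is $X_F^+=\{(x_1,x_2,\ldots)\in X^{\mathbb N}: (x_i,x_{i+1})\in F \text{ for every } i\ge 1\}$, with the topology inherited from the product topology. $(r,\rho)\in\mathcal{NC}$ (''$r$ and $\rho$ never connect'') means: $0<r<1<\rho$, and for all integers $k,l$, $r^k=\rho^l$ if and only if $k=l=0$. For an integer $M\ge 2$, a set $\Omega=\{\omega_1,\ldots,\omega_M\}$ of positive real numbers is LF-inducing if $\omega_1<1<\omega_2$ and $(\omega_1,\omega_2)\in\mathcal{NC}$. For such $\Omega$, $F_\Omega=\bigcup_{j=1}^M\{(x,y)\in I^2: y=\omega_j x\}$. A continuum is a nonempty compact connected metric space. A fan is an arcwise connected, hereditarily unicoherent continuum with exactly one ramification point (its top $v$). It is smooth if whenever $x_n\to x$, the unique arcs from $v$ to $x_n$ converge in the Hausdorff metric to the unique arc from $v$ to $x$. An endpoint is a point that is an endpoint of every arc containing it. A Lelek fan is a smooth fan whose set of endpoints is dense (it is unique up to homeomorphism). *)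

(* Defs.v *)
From mathcomp Require Import all_boot all_order all_algebra.
From mathcomp Require Import all_classical all_reals all_analysis.

Set Implicit Arguments.
Unset Strict Implicit.
Unset Printing Implicit Defensive.

Import Order.TTheory GRing.Theory Num.Theory.
Import numFieldNormedType.Exports.

Local Open Scope classical_set_scope.
Local Open Scope ring_scope.

(* Spaces are subsets X of an ambient topological space T, carrying the
   subspace topology. *)

(* d is a metric on X inducing the subspace topology of X; the values of d
   outside of X are irrelevant. *)
Definition metrizes (R : realType) (T : topologicalType) (X : set T)
    (d : T -> T -> R) : Prop :=
  [/\ forall x y, X x -> X y -> 0 <= d x y,
      forall x y, X x -> X y -> (d x y = 0 <-> x = y),
      forall x y, X x -> X y -> d x y = d y x,
      forall x y z, X x -> X y -> X z -> d x z <= d x y + d y z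
    & forall x (U : set T), X x ->
        (within X (nbhs x) U <->
         exists2 e : R, 0 < e & forall y, X y -> d x y < e -> U y)].

Definition continuum (R : realType) (T : topologicalType) (X : set T) : Prop :=
  [/\ X !=set0, compact X, connected X & exists d : T -> T -> R, metrizes X d].

Definition subcontinuum (R : realType) (T : topologicalType) (A X : set T) :
    Prop :=
  continuum R A /\ A `<=` X.

Definition unicoherent (R : realType) (T : topologicalType) (X : set T) :
    Prop :=
  forall A B : set T, subcontinuum R A X -> subcontinuum R B X ->
    X = A `|` B -> connected (A `&` B).

Definition hereditarily_unicoherent (R : realType) (T : topologicalType)
    (X : set T) : Prop :=
  forall Y : set T, subcontinuum R Y X -> unicoherent R Y.

(* A is the image of [0, 1] under a homeomorphism f (with inverse g) sending
   0 to a and 1 to b. *)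
Definition arc_from_to (R : realType) (T : topologicalType) (A : set T)
    (a b : T) : Prop :=
  exists (f : R -> T) (g : T -> R),
    [/\ f @` `[0, 1] = A, {in `[0, 1], cancel f g},
        {within `[0, 1], continuous f}, {within A, continuous g}
      & f 0 = a /\ f 1 = b].

Definition arc (R : realType) (T : topologicalType) (A : set T) : Prop :=
  exists a b : T, arc_from_to R A a b.

Definition arc_endpoint (R : realType) (T : topologicalType) (A : set T)
    (x : T) : Prop :=
  exists y : T, arc_from_to R A x y.

Definition arcwise_connected (R : realType) (T : topologicalType)
    (X : set T) : Prop :=
  forall x y : T, X x -> X y -> x <> y ->
    exists2 A : set T, A `<=` X & arc_from_to R A x y.

(* x is the vertex of a simple triod contained in X *)
Definition ramification_point (R : realType) (T : topologicalType)
    (X : set T) (x : T) : Prop :=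
  exists A1 A2 A3 : set T,
    [/\ [/\ A1 `<=` X, A2 `<=` X & A3 `<=` X],
        [/\ arc_endpoint R A1 x, arc_endpoint R A2 x & arc_endpoint R A3 x]
      & [/\ A1 `&` A2 = [set x], A1 `&` A3 = [set x] & A2 `&` A3 = [set x]]].

Definition endpoint (R : realType) (T : topologicalType) (X : set T)
    (x : T) : Prop :=
  X x /\ forall A : set T, A `<=` X -> arc R A -> A x -> arc_endpoint R A x.

Definition fan_with_top (R : realType) (T : topologicalType) (X : set T)
    (v : T) : Prop :=
  [/\ continuum R X, arcwise_connected R X, hereditarily_unicoherent R X
    & unique (ramification_point R X) v].

Definition hausdorff_dist (R : realType) (T : Type) (d : T -> T -> R)
    (A B : set T) : R :=
  inf [set r : R | [/\ 0 < r,
                       forall a, A a -> exists2 b, B b & d a b < r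
                     & forall b, B b -> exists2 a, A a & d b a < r]].

(* the arc from a to a is the point a *)
Definition arc_or_point (R : realType) (T : topologicalType) (A : set T)
    (a b : T) : Prop :=
  (a = b /\ A = [set a]) \/ arc_from_to R A a b.

(* Every metric inducing the topology of X is considered: on a compact space
   Hausdorff convergence of compact sets does not depend on this choice.  The
   arcs from v are unique as soon as X is a fan. *)
Definition smooth_at (R : realType) (T : topologicalType) (X : set T)
    (v : T) : Prop :=
  forall d : T -> T -> R, metrizes X d ->
  forall (x_ : nat -> T) (x : T), (forall n, X (x_ n)) -> X x ->
    x_ @ \oo --> x ->
  forall (A_ : nat -> set T) (A : set T),
    (forall n, A_ n `<=` X /\ arc_or_point R (A_ n) v (x_ n)) ->
    A `<=` X /\ arc_or_point R A v x ->
    (fun n => hausdorff_dist d (A_ n) A) @ \oo --> (0 : R).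

Definition smooth_fan (R : realType) (T : topologicalType) (X : set T) :
    Prop :=
  exists v : T, fan_with_top R X v /\ smooth_at R X v.

Definition Lelek_fan (R : realType) (T : topologicalType) (X : set T) : Prop :=
  smooth_fan R X /\ X `<=` closure (endpoint R X).

(* {ptws nat -> X} carries the product topology; coordinates are indexed
   from 0. *)
Definition mahavier_product (X : topologicalType) (F : set (X * X)) :
    set {ptws nat -> X} :=
  [set x | forall i : nat, F (x i, x i.+1)].

Definition never_connect (R : realType) (r rho : R) : Prop :=
  [/\ 0 < r, r < 1, 1 < rho
    & forall k l : int, r ^ k = rho ^ l <-> k = 0 /\ l = 0].

(* omega_j is the entry of index j - 1; repetitions are allowed. *)
Definition LF_inducing (R : realType) (M : nat) (Omega : M.-tuple R) : Prop :=
  [/\ (2 <= M)%N,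
      forall w : R, w \in Omega -> 0 < w,
      Omega`_0 < 1 /\ 1 < Omega`_1
    & never_connect Omega`_0 Omega`_1].

(* F_Omega is a subset of I^2, so its Mahavier product taken over R is the one
   taken over I = [0, 1]. *)
Definition F_ (R : realType) (M : nat) (Omega : M.-tuple R) : set (R * R) :=
  [set p | [/\ 0 <= p.1 <= 1, 0 <= p.2 <= 1
             & exists2 w, w \in Omega & p.2 = w * p.1]].

(* Main.v *)
Require Import Defs.
From mathcomp Require Import all_boot all_order all_algebra.
From mathcomp Require Import all_classical all_reals all_analysis.
From mathcomp Require Import ring lra.

Import numFieldNormedType.Exports.

(** The zero sequence is the top.  A nonzero point is determined by its first
    coordinate and its direction, the sequence of ratios of its coordinates to
    the first one; each such ratio takes only finitely many values, so the set
    of directions is totally disconnected and the space is a star of segments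
    issued from the origin.  Hence a closed connected subset is convex along
    every ray, and contains the origin as soon as it meets two of them: this
    gives hereditary unicoherence, the uniqueness of the arcs issued from the
    origin, and the fact that no other point is a vertex of a triod.

    A nonzero point whose coordinates have supremum 1 cannot be moved outwards
    and is an endpoint.  Since [omega_1] and [omega_2] never connect, the
    products [omega_1 ^ a * omega_2 ^ b] are dense near 1; so the first [n]
    coordinates of any nonzero point can be continued within [0, 1] to a
    sequence with supremum close to 1, and rescaling yields an endpoint close
    to the given point. *)

Set Implicit Arguments.
Unset Strict Implicit.
Unset Printing Implicit Defensive.

Import Order.TTheory GRing.Theory Num.Theory.

Local Open Scope classical_set_scope.
Local Open Scope ring_scope.

(** * Sequences with the product topology *)

Section RealFunctions.
Context {R : realType} (S : topologicalType).
Implicit Types f g : S -> R.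

Lemma cst_cont (a : R) : continuous (fun _ : S => a).
Proof. by move=> s; exact: cvg_cst. Qed.

Lemma mul_cont f g : continuous f -> continuous g ->
  continuous (fun s => f s * g s).
Proof. by move=> fc gc s; apply: continuousM; [exact: fc|exact: gc]. Qed.

Lemma add_cont f g : continuous f -> continuous g ->
  continuous (fun s => f s + g s).
Proof. by move=> fc gc s; apply: cvgD; [exact: fc|exact: gc]. Qed.

Lemma opp_cont f : continuous f -> continuous (fun s => - f s).
Proof. by move=> fc s; apply: cvgN; exact: fc. Qed.

Lemma prod_cont (I : Type) (r : seq I) (P : pred I) (F : I -> S -> R) :
  (forall i, continuous (F i)) -> continuous (fun s => \prod_(i <- r | P i) F i s).
Proof.
move=> Fc; elim: r => [|i r IHr].
  rewrite (_ : (fun _ => _) = fun=> 1); first exact: cst_cont.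
  by apply/funext => s; rewrite big_nil.
case Pi : (P i); last first.
  rewrite (_ : (fun _ => _) = fun s => \prod_(j <- r | P j) F j s) //.
  by apply/funext => s; rewrite big_cons Pi.
rewrite (_ : (fun _ => _) = fun s => F i s * \prod_(j <- r | P j) F j s).
  exact: mul_cont.
by apply/funext => s; rewrite big_cons Pi.
Qed.

Lemma closed_zero f : continuous f -> closed [set s | f s = 0].
Proof. by move/continuous_closedP => /(_ _ (@closed_eq _ 0)). Qed.

Lemma open_neq0 f : continuous f -> open [set s | f s != 0].
Proof. by move/continuousP => /(_ _ (@open_neq _ 0)). Qed.

Lemma open_gtf f (a : R) : continuous f -> open [set s | a < f s].
Proof. by move/continuousP => /(_ _ (@open_gt _ a)). Qed.

Lemma closed_gef f (a : R) : continuous f -> closed [set s | a <= f s].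
Proof. by move/continuous_closedP => /(_ _ (@closed_ge _ a)). Qed.

Lemma id_cont : continuous (fun a : R => a).
Proof. by move=> a; exact: cvg_id. Qed.

End RealFunctions.

Section Sequences.
Context {R : realType}.
Local Notation T := {ptws nat -> R}.
Implicit Types x y z : T.

Lemma proj_cont i : continuous (fun z : T => z i).
Proof. exact: (@proj_continuous nat (fun=> R) i). Qed.

Lemma ptws_hausdorff : hausdorff_space T.
Proof. by apply: (@hausdorff_product nat (fun=> R)) => _; exact: norm_hausdorff. Qed.

Lemma nbhs_coord x i e : 0 < e -> nbhs x [set z : T | `|x i - z i| < e].
Proof. by move=> e0; have /cvgrPdist_lt /(_ _ e0) := @proj_cont i x. Qed.

Lemma nbhs_box x n e : 0 < e ->
  nbhs x [set z : T | forall i, (i <= n)%N -> `|x i - z i| < e].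
Proof.
move=> e0; elim: n => [|n IHn].
  have xn := @nbhs_coord x 0%N e e0.
  apply: (@filterS _ _ (nbhs_filter x) _ _ _ xn) => z /= xz i.
  rewrite leqn0 => /eqP ->.
  exact: xz.
have xn := @nbhs_coord x n.+1 e e0.
apply: (@filterS _ _ (nbhs_filter x) _ _ _
  (@filterI _ _ (nbhs_filter x) _ _ IHn xn)).
move=> z /= [zn zS] i.
rewrite leq_eqVlt ltnS => /predU1P[->|]; first by exact: zS.
exact: zn.
Qed.

(** Otherwise each [n] gives a point outside [U] that is [1/(n+1)]-close to [x] on the coordinates
    up to [n]. These points converge to [x] pointwise, hence in the product topology, and so enter
    [U]. *)
Lemma nbhs_boxP x (U : set T) : nbhs x U -> exists n (e : R), 0 < e /\
  forall z, (forall i, (i <= n)%N -> `|x i - z i| < e) -> U z.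
Proof.
move=> xU; apply: contrapT => noBox.
have H (n : nat) : exists z : T,
    (forall i, (i <= n)%N -> `|x i - z i| < n.+1%:R^-1) /\ ~ U z.
  apply: contrapT => noz; apply: noBox; exists n, n.+1%:R^-1; split=> // z zx.
  by apply: contrapT => nUz; apply: noz; exists z.
have [z_ zP] := choice H.
have zx : {ptws, z_ @ \oo --> x}.
  apply/pointwise_cvgP => i.
  change ((fun n => z_ n i) @ \oo --> x i); apply/cvgrPdist_lt => e e0.
  near=> n; have ni : `|x i - z_ n i| < n.+1%:R^-1.
    by apply: (zP n).1; near: n; exists i.
  apply: (lt_trans ni).
  by near: n; exact: near_infty_natSinv_lt (PosNum e0).
have [N _ /(_ N (leqnn N))] := zx _ xU.
exact: (zP N).2.
Unshelve. all: by end_near. Qed.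

Lemma continuous_ptws (S : topologicalType) (f : S -> T) :
  (forall i, continuous (fun s => f s i)) -> continuous f.
Proof.
move=> fc s.
have H : {ptws, f @ s --> f s}.
  by apply/pointwise_cvgP => i; exact: (fc i s).
exact: H.
Qed.

Definition scale (c : R) x : T := fun i => c * x i.
Definition origin : T := fun=> 0.
Definition line x y (t : R) : T := fun i => (1 - t) * x i + t * y i.

Lemma scale1 x : scale 1 x = x.
Proof. by apply/funext => i; rewrite /scale mul1r. Qed.

Lemma scale0 x : scale 0 x = origin.
Proof. by apply/funext => i; rewrite /scale mul0r. Qed.

Lemma scaleA a b x : scale a (scale b x) = scale (a * b) x.
Proof. by apply/funext => i; rewrite /scale mulrA. Qed.

Lemma scaler_origin a : scale a origin = origin.
Proof. by apply/funext => i; rewrite /scale mulr0. Qed.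

Lemma scaling_continuous : continuous (fun p : R * T => scale p.1 p.2).
Proof.
apply: continuous_ptws => i; apply: (mul_cont (f := fst)).
  by move=> p; exact: cvg_fst.
move=> p; apply: (@continuous_comp _ _ _ snd (fun z : T => z i)).
  exact: cvg_snd.
exact: proj_cont.
Qed.

Lemma ray_continuous x : continuous (scale ^~ x).
Proof.
apply: continuous_ptws => i.
by apply: mul_cont; [exact: id_cont|exact: cst_cont].
Qed.

Lemma line_continuous x y : continuous (line x y).
Proof.
apply: continuous_ptws => i; apply: add_cont; apply: mul_cont.
- by apply: add_cont; [exact: cst_cont|apply: opp_cont; exact: id_cont].
- exact: cst_cont.
- exact: id_cont.
- exact: cst_cont.
Qed.

Lemma star_connected (D : set T) p : D p ->
  (forall y, D y -> line p y @` `[0, 1] `<=` D) -> connected D.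
Proof.
move=> Dp starD.
have -> : D = \bigcup_(y in D) (line p y @` `[0, 1]).
  apply/seteqP; split=> [y Dy|y [z Dz]]; last exact: starD.
  exists y => //; exists 1; first by rewrite /= in_itv /= lexx ler01.
  by apply/funext => i; rewrite /line subrr mul0r mul1r add0r.
apply: bigcup_connected.
  exists p => y _; exists 0; first by rewrite /= in_itv /= lexx ler01.
  by apply/funext => i; rewrite /line subr0 mul0r mul1r addr0.
move=> y _; apply: connected_continuous_connected; first exact: segment_connected.
by apply: continuous_subspaceT; exact: line_continuous.
Qed.

End Sequences.

(** * Convexity along the rays *)

Section Rays.
Context {R : realType} (M : nat) (Omega : M.-tuple R).
Hypothesis M_ge2 : (2 <= M)%N.
Hypothesis Omega_gt0 : forall w : R, w \in Omega -> 0 < w.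
Local Notation T := {ptws nat -> R}.
Local Notation X := (mahavier_product (F_ Omega)).
Implicit Types (x y z : T) (D : set T).

Lemma XP x : X x <-> (forall i, 0 <= x i <= 1) /\
  (forall i, exists2 w, w \in Omega & x i.+1 = w * x i).
Proof.
split=> [Xx|[x01 xM] i]; last by split=> /=.
by split=> i; case: (Xx i).
Qed.

Lemma X_ge0 x i : X x -> 0 <= x i.
Proof. by move=> /XP[/(_ i)/andP[]]. Qed.

Lemma X_le1 x i : X x -> x i <= 1.
Proof. by move=> /XP[/(_ i)/andP[]]. Qed.

Lemma X_scale x c : X x -> 0 <= c -> (forall i, c * x i <= 1) -> X (scale c x).
Proof.
move=> /[dup] Xx /XP[_ xM] c0 cx1; apply/XP; split=> i.
  by rewrite /scale cx1 mulr_ge0 //; exact: X_ge0.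
by have [w wO xi] := xM i; exists w => //; rewrite /scale xi mulrCA.
Qed.

Lemma X_shrink x c : X x -> 0 <= c <= 1 -> X (scale c x).
Proof.
move=> Xx /andP[c0 c1]; apply: X_scale => // i.
by rewrite mulr_ile1 //; [exact: X_ge0|exact: X_le1].
Qed.

(** All products of [i] members of [Omega]: the only possible values of [x i / x 0] on [X]. *)
Fixpoint ratios (i : nat) : seq R :=
  if i is j.+1 then [seq w * q | w <- Omega, q <- ratios j] else [:: 1].

Lemma X_ratio x i : X x -> exists2 q, q \in ratios i & x i = q * x 0%N.
Proof.
move=> /XP[_ xM]; elim: i => [|i [q qr xi]]; first by exists 1; rewrite ?inE ?mul1r.
have [w wO ->] := xM i; exists (w * q); last by rewrite xi mulrA.
by apply/allpairsP; exists (w, q).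
Qed.

Lemma ratios_gt0 i q : q \in ratios i -> 0 < q.
Proof.
elim: i q => [q|i IHi q]; first by rewrite inE => /eqP ->.
move=> /allpairsP[[w p] /= [wO pr ->]].
by apply: mulr_gt0; [exact: Omega_gt0|exact: IHi].
Qed.

Lemma X_eq0 x : X x -> x 0%N = 0 -> x = origin.
Proof.
move=> Xx x0; apply/funext => i.
by have [q _ ->] := X_ratio i Xx; rewrite x0 mulr0.
Qed.

Lemma X_gt0 x : X x -> x <> origin -> 0 < x 0%N.
Proof.
move=> Xx xN0; rewrite lt_neqAle X_ge0 // andbT eq_sym.
by apply/eqP => /(X_eq0 Xx).
Qed.

Lemma X_gt0P x i : X x -> 0 < x 0%N -> 0 < x i.
Proof.
by move=> Xx x0; have [q /ratios_gt0 q0 ->] := X_ratio i Xx; rewrite mulr_gt0.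
Qed.

(** Equality of directions, cross-multiplied to avoid division; the origin is collinear with every
    point. *)
Definition collinear x y := forall i, y i * x 0%N = x i * y 0%N.

Lemma collinear_sym x y : collinear x y -> collinear y x.
Proof. by move=> xy i; rewrite xy. Qed.

Lemma collinear_scale x y : X x -> X y -> collinear x y -> y 0%N <= x 0%N ->
  exists2 c, 0 <= c <= 1 & y = scale c x.
Proof.
move=> Xx Xy xy yx; have [x0|x0] := eqVneq (x 0%N) 0.
  exists 1; first by rewrite ler01 lexx.
  rewrite scale1 (X_eq0 Xx x0) (X_eq0 Xy) //.
  by apply/eqP; rewrite eq_le (X_ge0 0%N Xy) -x0 yx.
have x0p : 0 < x 0%N by rewrite lt_neqAle eq_sym x0 X_ge0.
exists (y 0%N / x 0%N).
  by rewrite divr_ge0 ?X_ge0 //= ler_pdivrMr // mul1r.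
by apply/funext => i; apply: (mulIf x0); rewrite /scale xy; field.
Qed.

Lemma X_closed : closed X.
Proof.
(* As [Omega] is finite, the existence of a suitable [w] is the vanishing of one product, which is a
   closed condition. *)
have -> : X = \bigcap_(i in setT) ([set z : T | 0 <= z i] `&`
    [set z : T | 0 <= 1 - z i] `&`
    [set z : T | \prod_(w <- Omega) (z i.+1 - w * z i) = 0]).
  apply/seteqP; split=> [x /XP[x01 xM] i _|x xP].
    have /andP[x0 x1] := x01 i; split; first by split=> //=; rewrite subr_ge0.
    have [w wO xi] := xM i; apply/eqP; rewrite prodf_seq_eq0.
    by apply/hasP; exists w => //=; rewrite xi subrr.
  apply/XP; split=> i; have [[/= x0 +] /eqP] := xP i I; rewrite subr_ge0 => x1.
    by rewrite x0 x1.
  rewrite prodf_seq_eq0 => /hasP[w wO /=]; rewrite subr_eq0 => /eqP xi.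
  by exists w.
apply: closed_bigI => i _; apply: closedI; first apply: closedI.
- apply: (@closed_gef _ _ (fun z : T => z i)).
  exact: proj_cont.
- apply: (@closed_gef _ _ (fun z : T => 1 - z i)).
  apply: add_cont; first exact: cst_cont.
  by apply: opp_cont; exact: proj_cont.
- apply: closed_zero.
  apply: (@prod_cont _ _ _ _ _ (fun w (z : T) => z i.+1 - w * z i)) => w.
  apply: add_cont; first exact: proj_cont.
  by apply/opp_cont/mul_cont; [exact: cst_cont|exact: proj_cont].
Qed.

Lemma X_compact : compact X.
Proof.
have cube : compact [set f : T | forall i, `[(0:R), 1]%classic (f i)].
  exact: (@tychonoff nat (fun=> R) (fun=> `[0, 1]%classic)
    (fun=> @segment_compact R 0 1)).
apply: subclosed_compact cube _; first exact: X_closed.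
by move=> x /XP[x01 _] i; rewrite /= in_itv /=; exact: x01.
Qed.

Definition agree n x z := forall i, (i <= n)%N -> z i * x 0%N = x i * z 0%N.

Lemma agree_closed n x : closed [set z | agree n x z].
Proof.
have -> : [set z | agree n x z] = \bigcap_(i in [set i | (i <= n)%N])
    [set z : T | z i * x 0%N - x i * z 0%N = 0].
  apply/seteqP; split=> [z zx i /= le_in|z zx i le_in].
    by apply/eqP; rewrite subr_eq0; apply/eqP; exact: zx.
  by apply/eqP; rewrite -subr_eq0; apply/eqP; exact: (zx i le_in).
apply: closed_bigI => i _; apply: closed_zero.
apply: add_cont; first by apply: mul_cont; [exact: proj_cont|exact: cst_cont].
by apply/opp_cont/mul_cont; [exact: cst_cont|exact: proj_cont].
Qed.

(* Each ratio [z i / z 0] takes finitely many values on [X], so agreement with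
   [x] is the nonvanishing of the differences with all the other values. *)
Definition disagreement n x z : R := \prod_(i <- iota 0 n.+1)
  \prod_(q <- ratios i | q * x 0%N != x i) (z i - q * z 0%N).

Lemma disagreement_continuous n x : continuous (disagreement n x).
Proof.
apply: (@prod_cont _ _ _ _ _ (fun i (z : T) =>
  \prod_(q <- ratios i | q * x 0%N != x i) (z i - q * z 0%N))) => i.
apply: (@prod_cont _ _ _ _ _ (fun q (z : T) => z i - q * z 0%N)) => q.
apply: add_cont; first exact: proj_cont.
by apply/opp_cont/mul_cont; [exact: cst_cont|exact: proj_cont].
Qed.

(** Among nonzero points of [X], agreement is closed by its equations and also open, as the
    nonvanishing of a continuous function. *)
Lemma agreeP n x z : X x -> 0 < x 0%N -> X z -> 0 < z 0%N ->
  agree n x z <-> disagreement n x z != 0.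
Proof.
move=> Xx x0 Xz z0; split=> [zx|].
  apply/negP; rewrite prodf_seq_eq0 => /hasP[i]; rewrite mem_iota ltnS => /= ilen.
  rewrite prodf_seq_eq0 => /hasP[q qr /andP[/eqP qx]].
  rewrite subr_eq0 => /eqP zi; apply: qx.
  apply: (mulIf (lt0r_neq0 z0)); rewrite -(zx _ ilen) zi; ring.
move=> dis i ilen; have [q qr zi] := X_ratio i Xz.
have [qx|qx] := eqVneq (q * x 0%N) (x i); first by rewrite zi -qx; ring.
case/eqP: dis; apply/eqP; rewrite prodf_seq_eq0; apply/hasP; exists i.
  by rewrite mem_iota.
rewrite /= prodf_seq_eq0; apply/hasP; exists q => //.
by rewrite qx zi subrr eqxx.
Qed.

(** The points of [D] that agree with [x] and have height above [c] form a clopen part of [D]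
    containing [x]. Openness comes from [disagreement]; closedness holds because no agreeing point
    of [D] has height exactly [c]. *)
Lemma connected_agree D n x (c : R) : closed D -> connected D -> D `<=` X ->
  D x -> 0 <= c < x 0%N -> (forall z, D z -> agree n x z -> z 0%N <> c) ->
  forall z, D z -> agree n x z /\ c < z 0%N.
Proof.
move=> Dcl Dco DX Dx /andP[c0 cx] Dc z.
have x0 : 0 < x 0%N := le_lt_trans c0 cx.
suff -> : D = D `&` [set z | agree n x z /\ c < z 0%N] by case.
apply/esym; apply: Dco.
- by exists x; split=> //; split=> // i _.
- exists ([set z : T | disagreement n x z != 0] `&` [set z : T | c < z 0%N]).
    apply: openI; first by apply: open_neq0; exact: disagreement_continuous.
    by apply: (@open_gtf _ _ (fun z : T => z 0%N)); exact: proj_cont.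
  apply/seteqP; split=> y [Dy /= [yP cy]]; split=> //; split=> //;
    by apply/agreeP => //; [exact: DX|exact: DX|exact: le_lt_trans cy].
- exists ([set z | agree n x z] `&` [set z : T | c <= z 0%N]).
    apply: closedI; first exact: agree_closed.
    by apply: (@closed_gef _ _ (fun z : T => z 0%N)); exact: proj_cont.
  apply/seteqP; split=> y [Dy /= [yP cy]]; split=> //; split=> //.
    exact: ltW.
  by rewrite lt_neqAle cy andbT eq_sym; apply/eqP; exact: Dc.
Qed.

(** A substitute for connectedness that, unlike it, passes to intersections. It follows from
    connectedness for closed subsets of [X] and always implies it. *)
Definition ray_convex D :=
  [/\ D `<=` X,
      forall x a b, D x -> D (scale a x) -> 0 <= a <= b -> b <= 1 ->
        D (scale b x)
    & forall x y, D x -> D y -> ~ D origin -> collinear x y].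

Lemma connected_ray_convex D : closed D -> connected D -> D `<=` X ->
  ray_convex D.
Proof.
move=> Dcl Dco DX; split=> // [x a b Dx Dax /andP[a0 ab] b1|x y Dx Dy D0].
- have [->|aNb] := eqVneq b a; first by [].
  have [->|bN1] := eqVneq b 1; first by rewrite scale1.
  have [x0|/eqP xN0] := eqVneq x origin; first by move: Dx; rewrite x0 scaler_origin.
  have x0 := X_gt0 (DX _ Dx) xN0.
  apply: contrapT => nDbx.
  have ocD : open (~` D) by exact: closed_openC.
  (* If [D] misses [scale b x], it misses a box around it. A point agreeing with [x] up to [n] at
     height [b * x 0] lies in that box, so [connected_agree] keeps all of [D] above this height,
     including [scale a x], which is absurd. *)
  have [n [e [e0 Dbox]]] : exists n (e : R), 0 < e /\
      forall z, (forall i, (i <= n)%N -> `|scale b x i - z i| < e) -> ~ D z.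
    by apply: nbhs_boxP; exact: open_nbhs_nbhs.
  have bx : 0 <= b * x 0%N < x 0%N.
    by rewrite mulr_ge0 ?(le_trans a0 ab) ?ltW //= gtr_pMl // lt_neqAle bN1.
  have [|_ /=] := @connected_agree D n x _ Dcl Dco DX Dx bx _ _ Dax.
    move=> z Dz zx z0; apply: Dbox Dz => i ilen.
    suff -> : z i = scale b x i by rewrite subrr normr0.
    by apply: (mulIf (lt0r_neq0 x0)); rewrite zx // z0 /scale; ring.
  by rewrite /scale ltr_pM2r // ltNge ab.
- have x0 : 0 < x 0%N.
    by apply: X_gt0 => [|xo]; [exact: DX|apply: D0; rewrite -xo].
  (* Here the forbidden height is 0, attained in [X] by the origin only. *)
  move=> i; have x00 : 0 <= (0 : R) < x 0%N by apply/andP; split.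
  have [|+ _] := @connected_agree D i x _ Dcl Dco DX Dx x00 _ _ Dy; last exact.
  by move=> z Dz _ z0; apply: D0; rewrite -(X_eq0 (DX _ Dz) z0).
Qed.

Lemma ray_convexI D E : ray_convex D -> ray_convex E -> ray_convex (D `&` E).
Proof.
move=> [DX Dc Dl] [_ Ec El]; split=> [x [/DX]//|x a b [Dx Ex] [Da Ea] ab b1|].
  by split; [exact: Dc ab b1|exact: Ec ab b1].
move=> x y [Dx Ex] [Dy Ey] nDE; have [D0|D0] := pselect (D origin).
  by apply: El => // E0; exact: nDE.
exact: Dl.
Qed.

(** [D] is star-shaped: about the origin if it contains it, and otherwise about any of its points,
    since it then lies on a single ray. *)
Lemma ray_convex_connected D : ray_convex D -> connected D.
Proof.
move=> [DX Dc Dl]; have [D0|D0] := pselect (D origin).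
  apply: (star_connected D0) => y Dy _ [t /= /[!in_itv] /= /andP[t0 t1] <-].
  have -> : line origin y t = scale t y.
    by apply/funext => i; rewrite /line /scale /origin mulr0 add0r.
  by apply: (Dc y 0) => //; rewrite ?scale0 ?lexx ?t0.
have [->|/set0P[p Dp]] := eqVneq D set0; first exact: connected0.
apply: (star_connected Dp) => y Dy _ [t /= /[!in_itv] /= /andP[t0 t1] <-].
have [yp|/ltW py] := leP (y 0%N) (p 0%N).
  have [c /andP[c0 c1] yE] := collinear_scale (DX _ Dp) (DX _ Dy) (Dl _ _ Dp Dy D0) yp.
  have -> : line p y t = scale (1 - t + t * c) p.
    by apply/funext => i; rewrite /line yE /scale; ring.
  by apply: (Dc p c) => //; [rewrite -yE|nra|nra].
have [c /andP[c0 c1] pE] := collinear_scale (DX _ Dy) (DX _ Dp) (Dl _ _ Dy Dp D0) py.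
have -> : line p y t = scale ((1 - t) * c + t) y.
  by apply/funext => i; rewrite /line pE /scale; ring.
by apply: (Dc y c) => //; [rewrite -pE|nra|nra].
Qed.

Lemma X_hereditarily_unicoherent : hereditarily_unicoherent R X.
Proof.
move=> Y [_ YX] A B [[_ Ac Aco _] AY] [[_ Bc Bco _] BY] _.
apply: ray_convex_connected; apply: ray_convexI; apply: connected_ray_convex => //.
- exact: compact_closed ptws_hausdorff Ac.
- by move=> z /AY/YX.
- exact: compact_closed ptws_hausdorff Bc.
- by move=> z /BY/YX.
Qed.

Lemma X_origin : X origin.
Proof.
apply/XP; split=> i; first by rewrite /origin lexx ler01.
exists Omega`_0; last by rewrite /origin mulr0.
by rewrite mem_nth // size_tuple ltnW.
Qed.

End Rays.

(** * Arcs *)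

Section Arcs.
Context {R : realType} (T : topologicalType).
Implicit Types (A S : set T) (a b : T).

Lemma arc_compact_connected A a b : arc_from_to R A a b ->
  [/\ compact A, connected A, A a & A b].
Proof.
move=> [f [g [<- _ fc _ [<- <-]]]]; split.
- by apply: continuous_compact fc _; exact: segment_compact.
- by apply: connected_continuous_connected fc; exact: segment_connected.
- by exists 0 => //; rewrite /= in_itv /= lexx ler01.
- by exists 1 => //; rewrite /= in_itv /= lexx ler01.
Qed.

Lemma arc_neq A a b : arc_from_to R A a b -> a <> b.
Proof.
move=> [f [g [_ fK _ _ [<- <-]]]] /(congr1 g).
rewrite !fK ?in_itv /= ?lexx ?ler01 // => /eqP.
by rewrite eq_sym oner_eq0.
Qed.

Lemma arc_sym A a b : arc_from_to R A a b -> arc_from_to R A b a.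
Proof.
move=> [f [g [fA fK fc gc [<- <-]]]].
have revc : continuous (fun s : R => 1 - s).
  by apply: add_cont; [exact: cst_cont|apply: opp_cont; exact: id_cont].
exists (fun t => f (1 - t)), (fun z => 1 - g z); split.
- rewrite -fA; apply/seteqP; split=> _ [t /= /[!in_itv] /= /andP[t0 t1] <-].
    by exists (1 - t) => //; rewrite /= in_itv /=; apply/andP; split; lra.
  exists (1 - t); first by rewrite /= in_itv /=; apply/andP; split; lra.
  by congr f; ring.
- move=> t /[!in_itv] /= /andP[t0 t1].
  by rewrite fK ?in_itv /=; [ring|apply/andP; split; lra].
- apply/subspace_continuousP => t /= /[!in_itv] /= /andP[t0 t1] W fW.
  have r01 : `[(0 : R), 1]%classic (1 - t).
    by rewrite /= in_itv /=; apply/andP; split; lra.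
  have /subspace_continuousP /(_ _ r01 W fW) fnW := fc.
  have fnW' : nbhs t [set s | `[(0 : R), 1]%classic (1 - s) -> W (f (1 - s))] :=
    revc t _ fnW.
  change (nbhs t [set s | `[(0 : R), 1]%classic s -> W (f (1 - s))]).
  apply: filterS fnW' => s sW /= /[!in_itv] /= /andP[s0 s1].
  have s01 : `[(0 : R), 1]%classic (1 - s).
    by rewrite /= in_itv /=; apply/andP; split; lra.
  exact: (sW s01).
- apply: (@within_continuous_comp _ _ _ _ g (fun u : R => 1 - u)) => //.
- by split; congr f; ring.
Qed.

(** Serves the explicit arcs below, where both the parametrization and its inverse are given by
    formulas continuous everywhere. *)
Lemma retract_arc (f : R -> T) (g : T -> R) a b : continuous f ->
  continuous g -> {in `[0, 1], cancel f g} -> f 0 = a -> f 1 = b ->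
  arc_from_to R (f @` `[0, 1]) a b.
Proof.
move=> fc gc fK; exists f, g; split=> //; exact: continuous_subspaceT.
Qed.

(** The parameters of the points of [S] form an interval containing 0 and 1, hence all of
    [[0, 1]]. *)
Lemma connected_sub_arc A S a b : arc_from_to R A a b -> S `<=` A ->
  connected S -> S a -> S b -> S = A.
Proof.
move=> [f [g [fA fK _ gc [fa fb]]]] SA Sco Sa Sb; apply/seteqP; split=> // z.
have itv0 : (0 : R) \in `[0, 1] by rewrite in_itv /= lexx ler01.
have itv1 : (1 : R) \in `[0, 1] by rewrite in_itv /= lexx ler01.
have : connected (g @` S).
  by apply: connected_continuous_connected => //; exact: continuous_subspaceW gc.
move/connected_intervalP => gS; rewrite -fA => -[t /= t01 <-].
have [||s Ss gs] := gS 0 1 _ _ t t01.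
- by exists a => //; rewrite -fa fK.
- by exists b => //; rewrite -fb fK.
have := SA _ Ss; rewrite -fA => -[u /= u01 us].
by rewrite -gs -us fK // us.
Qed.

End Arcs.

(** * Segments from the origin and arcwise connectedness *)

Section Fan.
Context {R : realType} (M : nat) (Omega : M.-tuple R).
Hypothesis M_ge2 : (2 <= M)%N.
Hypothesis Omega_gt0 : forall w : R, w \in Omega -> 0 < w.
Local Notation T := {ptws nat -> R}.
Local Notation X := (mahavier_product (F_ Omega)).
Implicit Types (x y z : T) (A D E : set T).

Lemma arc_ray_convex A x y : arc_from_to R A x y -> A `<=` X ->
  ray_convex Omega A.
Proof.
move=> /arc_compact_connected[Ac Aco _ _] AX; apply: connected_ray_convex => //.
exact: compact_closed ptws_hausdorff Ac.
Qed.

Definition segment x : set T := scale ^~ x @` `[0, 1].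

Lemma segment_sub x : X x -> segment x `<=` X.
Proof. by move=> Xx _ [c /= /[!in_itv] /= c01 <-]; exact: X_shrink. Qed.

Lemma segment_arc x : X x -> x <> origin -> arc_from_to R (segment x) origin x.
Proof.
move=> Xx /(X_gt0 Xx) x0; 
apply: (@retract_arc _ _ (scale ^~ x) (fun z : T => z 0%N * (x 0%N)^-1)).
- exact: ray_continuous.
- by apply: mul_cont; [exact: proj_cont|exact: cst_cont].
- by move=> t _; rewrite /scale mulfK // lt0r_neq0.
- exact: scale0.
- exact: scale1.
Qed.

(** By ray convexity the arc contains the segment, which is connected and joins both ends of the
    arc, so it exhausts the arc. *)
Lemma arc_segment A x : X x -> A `<=` X -> arc_from_to R A origin x ->
  A = segment x.
Proof.
move=> Xx AX Ax; have [_ _ A0 Axx] := arc_compact_connected Ax.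
have [_ Ac _] := arc_ray_convex Ax AX.
have itv0 : `[(0 : R), 1]%classic 0 by rewrite /= in_itv /= lexx ler01.
have itv1 : `[(0 : R), 1]%classic 1 by rewrite /= in_itv /= lexx ler01.
apply/esym; apply: (connected_sub_arc Ax).
- move=> _ [c /= /[!in_itv] /= /andP[c0 c1] <-].
  by apply: (Ac x 0) => //; [rewrite scale0|rewrite lexx].
- apply: connected_continuous_connected; first exact: segment_connected.
  apply: continuous_subspaceT; exact: ray_continuous.
- by exists 0; rewrite ?scale0.
- by exists 1; rewrite ?scale1.
Qed.

(** The path from [x] straight to the origin, reached at [t = 1/2], and then straight to [y]: the
    coefficients are the negative and positive parts of [2 * t - 1]. *)
Definition bent x y (t : R) : T := fun i =>
  (`|2 * t - 1| - (2 * t - 1)) / 2 * x i + (`|2 * t - 1| + (2 * t - 1)) / 2 * y i.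

Lemma bent_continuous x y : continuous (bent x y).
Proof.
have u_cont : continuous (fun t : R => 2 * t - 1).
  apply: add_cont; last exact: cst_cont.
  by apply: mul_cont; [exact: cst_cont|exact: id_cont].
have n_cont : continuous (fun t : R => `|2 * t - 1|).
  by move=> t; apply: (@continuous_comp _ _ _ (fun t : R => 2 * t - 1) Num.norm);
    [exact: u_cont|exact: norm_continuous].
apply: continuous_ptws => i; apply: add_cont; apply: mul_cont; try exact: cst_cont.
  by apply: mul_cont; [apply: add_cont => //; exact: opp_cont|exact: cst_cont].
by apply: mul_cont; [exact: add_cont|exact: cst_cont].
Qed.

Lemma X_arcwise_connected : arcwise_connected R X.
Proof.
move=> x y Xx Xy xy.
have [xyc|] := pselect (collinear x y).
  have yx0 : y 0%N - x 0%N != 0.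
    apply/eqP => /eqP; rewrite subr_eq0 => /eqP yx0; apply: xy.
    have [z0|z0] := eqVneq (x 0%N) 0.
      by rewrite (X_eq0 Xx z0) (X_eq0 Xy) // yx0.
    by apply/funext => i; apply: (mulIf z0); rewrite xyc yx0.
  exists (line x y @` `[0, 1]).
    have l01 t : t \in `[0, 1] -> X (line x y t).
      move=> /[!in_itv] /= /andP[t0 t1].
      have [yx|/ltW yx] := leP (y 0%N) (x 0%N).
        have [c /andP[c0 c1] yE] := collinear_scale Xx Xy xyc yx.
        have -> : line x y t = scale (1 - t + t * c) x.
          by apply/funext => i; rewrite /line yE /scale; ring.
        by apply: X_shrink => //; apply/andP; split; nra.
      have [c /andP[c0 c1] xE] := collinear_scale Xy Xx (collinear_sym xyc) yx.
      have -> : line x y t = scale ((1 - t) * c + t) y.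
        by apply/funext => i; rewrite /line xE /scale; ring.
      by apply: X_shrink => //; apply/andP; split; nra.
    by move=> _ [t t01 <-]; exact: l01.
  apply: (@retract_arc _ _ _ (fun z : T => (z 0%N - x 0%N) * (y 0%N - x 0%N)^-1)).
  - exact: line_continuous.
  - apply: mul_cont; last exact: cst_cont.
    by apply: add_cont; [exact: proj_cont|exact: cst_cont].
  - by move=> t _; rewrite /line; field.
  - by apply/funext => i; rewrite /line; ring.
  - by apply/funext => i; rewrite /line; ring.
(* On different rays the arc passes through the origin; the index [i] separates the two
   directions. *)
move=> /existsNP[i xyi].
exists (bent x y @` `[0, 1]).
  move=> _ [t /= /[!in_itv] /= /andP[t0 t1] <-].
  have [u0|/ltW u0] := leP 0 (2 * t - 1).
    have -> : bent x y t = scale (2 * t - 1) y.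
      by apply/funext => j; rewrite /bent /scale ger0_norm //; field.
    by apply: X_shrink => //; rewrite u0; lra.
  have -> : bent x y t = scale (1 - 2 * t) x.
    by apply/funext => j; rewrite /bent /scale ler0_norm //; field.
  by apply: X_shrink => //; apply/andP; split; lra.
have dN0 : y i * x 0%N - x i * y 0%N != 0 by rewrite subr_eq0; apply/eqP.
pose d := (y i * x 0%N - x i * y 0%N)^-1.
(* A linear form with value -1 at [x] and 1 at [y]. *)
pose phi z := ((z i * x 0%N - x i * z 0%N) - (y i * z 0%N - z i * y 0%N)) * d.
(* Along [bent x y] the form [phi] takes the value [2 * t - 1], from which [t] is recovered. *)
apply: (@retract_arc _ _ _ (fun z : T => (phi z + 1) / 2)).
- exact: bent_continuous.
- apply: mul_cont; last exact: cst_cont.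
  apply: add_cont; last exact: cst_cont.
  apply: mul_cont; last exact: cst_cont.
  have c1 (a : R) j : continuous (fun z : T => z j * a).
    by apply: mul_cont; [exact: proj_cont|exact: cst_cont].
  have c2 (a : R) j : continuous (fun z : T => a * z j).
    by apply: mul_cont; [exact: cst_cont|exact: proj_cont].
  apply: add_cont; first by apply: add_cont; [|apply: opp_cont].
  by apply: opp_cont; apply: add_cont; [|apply: opp_cont].
- by move=> t _; rewrite /phi /bent /d; field.
- by apply/funext => j; rewrite /bent mulr0 sub0r normrN1; field.
- apply/funext => j; rewrite /bent mulr1 (_ : 2 - 1 = 1) ?normr1; first by field.
  by ring.
Qed.

End Fan.

(** * Triods and endpoints *)

Section Ramification.
Context {R : realType} (M : nat) (Omega : M.-tuple R).
Hypothesis M_ge2 : (2 <= M)%N.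
Hypothesis Omega_gt0 : forall w : R, w \in Omega -> 0 < w.
Local Notation T := {ptws nat -> R}.
Local Notation X := (mahavier_product (F_ Omega)).
Implicit Types (x y z : T) (A D E : set T).

Lemma scale_fixed x c : X x -> x <> origin -> scale c x = x -> c = 1.
Proof.
move=> Xx /(X_gt0 Xx) x0 /(congr1 (fun z : T => z 0%N)); rewrite /scale => cx.
by apply: (mulIf (lt0r_neq0 x0)); rewrite mul1r.
Qed.

(** A set with a second point leaves [x] along the ray of [x], either towards the origin or away
    from it. *)
Lemma ray_convex_move D x y : ray_convex Omega D -> D x -> D y -> y <> x ->
  (exists2 c, 0 <= c < 1 & D (scale c x)) \/
  (exists2 z, D z & exists2 c, 0 <= c < 1 & x = scale c z).
Proof.
move=> [DX Dc Dl] Dx Dy yx; have [D0|D0] := pselect (D origin).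
  by left; exists 0; rewrite ?scale0 // lexx ltr01.
have Xx := DX _ Dx; have Xy := DX _ Dy.
have lt1 c u v : 0 <= c <= 1 -> u = scale c v -> u <> v -> 0 <= c < 1.
  move=> /andP[-> c1] uE uv /=; rewrite lt_neqAle c1 andbT; apply/eqP => c1'.
  by apply: uv; rewrite uE c1' scale1.
have [le_yx|/ltW le_xy] := leP (y 0%N) (x 0%N).
  have [c c01 yE] := collinear_scale Xx Xy (Dl _ _ Dx Dy D0) le_yx.
  by left; exists c; [exact: lt1 yE yx|rewrite -yE].
have [c c01 xE] := collinear_scale Xy Xx (Dl _ _ Dy Dx D0) le_xy.
by right; exists y => //; exists c => //; apply: lt1 xE _ => // /esym.
Qed.

(** Both sets contain the higher of the two inner points, which differs from [x]. *)
Lemma disjoint_down D E x c d : ray_convex Omega D -> ray_convex Omega E ->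
  D `&` E = [set x] -> x <> origin -> 0 <= c < 1 -> 0 <= d < 1 ->
  D (scale c x) -> E (scale d x) -> False.
Proof.
move=> [DX Dc _] [_ Ec _] DE x0 /andP[c0 c1] /andP[d0 d1] Dcx Edx.
have [Dx Ex] : (D `&` E) x by rewrite DE.
have m1 : Num.max c d < 1 by rewrite gt_max c1.
suff mx : scale (Num.max c d) x = x.
  by move: m1; rewrite (scale_fixed (DX _ Dx) x0 mx) ltxx.
suff : (D `&` E) (scale (Num.max c d) x) by rewrite DE.
split; first by apply: (Dc x c) => //; rewrite ?(ltW m1) // c0 le_max lexx.
by apply: (Ec x d) => //; rewrite ?(ltW m1) // d0 le_max lexx orbT.
Qed.

(** The lower of the two outer points, [y] after the symmetry reduction, lies between [x] and [z] on
    their ray, so it belongs to [E] as well as to [D]. *)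
Lemma disjoint_up D E x y z c d : ray_convex Omega D -> ray_convex Omega E ->
  D `&` E = [set x] -> x <> origin -> 0 <= c < 1 -> 0 <= d < 1 ->
  D y -> E z -> x = scale c y -> x = scale d z -> False.
Proof.
wlog yz : D E y z c d / y 0%N <= z 0%N.
  move=> W rD rE DE x0 c01 d01 Dy Ez xy xz.
  have [yz|/ltW zy] := leP (y 0%N) (z 0%N); first exact: (W D E y z c d).
  by apply: (W E D z y d c) => //; rewrite setIC.
move=> [DX Dc _] [EX Ec _] DE x0 /andP[c0 c1] /andP[d0 d1] Dy Ez xy xz.
have [Dx Ex] : (D `&` E) x by rewrite DE.
have Xy := DX _ Dy; have Xz := EX _ Ez.
have cN0 : c != 0 by apply/eqP => cE; apply: x0; rewrite xy cE scale0.
have cd i : c * y i = d * z i.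
  by have := congr1 (fun u : T => u i) (etrans (esym xy) xz).
have zy : collinear z y.
  move=> i; apply: (mulfI cN0); rewrite mulrA cd [RHS]mulrCA cd; ring.
have [e /andP[e0 e1] yE] := collinear_scale Xz Xy zy yz.
have zN0 : z <> origin by move=> zE; apply: x0; rewrite xz zE scaler_origin.
have dE : d = c * e.
  apply: (mulIf (lt0r_neq0 (X_gt0 Xz zN0))).
  by rewrite -cd yE /scale mulrA.
suff yx : y = x.
  have cx : scale c x = x by rewrite -{1}yx -xy.
  by move: c1; rewrite (scale_fixed (DX _ Dx) x0 cx) ltxx.
suff : (D `&` E) y by rewrite DE.
split=> //; rewrite yE; apply: (Ec z d) => //; first by rewrite -xz.
by rewrite d0 dE ler_piMl // ltW.
Qed.

Lemma ramification_origin x : ramification_point R X x -> x = origin.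
Proof.
move=> [A1 [A2 [A3 [[A1X A2X A3X] [[y1 a1] [y2 a2] [y3 a3]] [A12 A13 A23]]]]].
apply: contrapT => x0.
have move_ A y : arc_from_to R A x y -> A `<=` X ->
    ray_convex Omega A /\ ((exists2 c, 0 <= c < 1 & A (scale c x)) \/
    (exists2 z, A z & exists2 c, 0 <= c < 1 & x = scale c z)).
  move=> xy AX; have rA := arc_ray_convex xy AX; split=> //.
  have [_ _ Ax Ay] := arc_compact_connected xy.
  by apply: ray_convex_move Ax Ay _ => // /esym; exact: arc_neq xy.
have [r1 m1] := move_ _ _ a1 A1X.
have [r2 m2] := move_ _ _ a2 A2X.
have [r3 m3] := move_ _ _ a3 A3X.
(* There are only two directions, so two of the three arcs leave [x] the same way and share more
   than [x]. *)
case: m1 => [[c1 c1b d1]|[z1 d1 [c1 c1b e1]]];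
case: m2 => [[c2 c2b d2]|[z2 d2 [c2 c2b e2]]];
case: m3 => [[c3 c3b d3]|[z3 d3 [c3 c3b e3]]].
- exact: (disjoint_down r1 r2 A12 x0 c1b c2b).
- exact: (disjoint_down r1 r2 A12 x0 c1b c2b).
- exact: (disjoint_down r1 r3 A13 x0 c1b c3b).
- exact: (disjoint_up r2 r3 A23 x0 c2b c3b d2 d3).
- exact: (disjoint_down r2 r3 A23 x0 c2b c3b).
- exact: (disjoint_up r1 r3 A13 x0 c1b c3b d1 d3).
- exact: (disjoint_up r1 r2 A12 x0 c1b c2b d1 d2).
- exact: (disjoint_up r1 r2 A12 x0 c1b c2b d1 d2).
Qed.

Lemma segmentI x y i : y i * x 0%N <> x i * y 0%N ->
  segment x `&` segment y = [set origin].
Proof.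
move=> xyi; have itv0 : `[(0 : R), 1]%classic 0 by rewrite /= in_itv /= lexx ler01.
apply/seteqP; split=> [z [[c c01 cz] [d d01 dz]]|_ ->]; last first.
  by split; exists 0; rewrite ?scale0.
have [c0|cN0] := eqVneq c 0; first by rewrite -cz c0 scale0.
have cd j : c * x j = d * y j.
  by have := congr1 (fun u : T => u j) (etrans cz (esym dz)).
exfalso; apply: xyi; apply: (mulfI cN0).
by rewrite mulrCA cd [RHS]mulrA cd; ring.
Qed.

Definition prepend (a : R) x : T := fun i => if i is j.+1 then x j else a.

Lemma X_prepend a x w : X x -> 0 <= a <= 1 -> w \in Omega -> x 0%N = w * a ->
  X (prepend a x).
Proof.
move=> /XP[x01 xM] a01 wO xa; apply/XP; split=> -[|i] /=.
- exact: a01.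
- exact: x01.
- by exists w.
- exact: xM.
Qed.

Definition powers (a w : R) : T := fun i => a * w ^+ i.

Lemma X_powers a w : w \in Omega -> w <= 1 -> 0 <= a <= 1 -> X (powers a w).
Proof.
move=> wO w1 /andP[a0 a1]; have w0 := Omega_gt0 wO.
apply/XP; split=> i.
  rewrite /powers mulr_ge0 ?exprn_ge0 ?(ltW w0) //=.
  by rewrite mulr_ile1 ?exprn_ge0 ?exprn_ile1 ?(ltW w0).
by exists w => //; rewrite /powers exprS mulrCA.
Qed.

Lemma origin_ramification w v : w \in Omega -> v \in Omega -> w < 1 -> 1 < v ->
  ramification_point R X origin.
Proof.
move=> wO vO w1 v1.
have w0 := Omega_gt0 wO; have v0 := Omega_gt0 vO.
have vi0 : 0 < v^-1 by rewrite invr_gt0.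
have vi1 : v^-1 <= 1 by rewrite invf_le1 // ltW.
have X1 : X (powers 1 w) by apply: X_powers => //; rewrite ?(ltW w1) // ler01 lexx.
have X2 : X (prepend v^-1 (powers 1 w)).
  apply: (X_prepend X1 _ vO); rewrite ?(ltW vi0) // /powers.
  by field; exact: lt0r_neq0.
have X2' : X (scale w (prepend v^-1 (powers 1 w))).
  by apply: (X_shrink X2); rewrite (ltW w0) (ltW w1).
have X3 : X (prepend v^-1 (scale w (prepend v^-1 (powers 1 w)))).
  by apply: (X_prepend X2' _ wO) => //; rewrite (ltW vi0).
have wv : 0 < 1 - w * v^-1 by rewrite subr_gt0 ltr_pdivrMr // mul1r (lt_trans w1).
have wwv := mulr_gt0 w0 wv; have vwv := mulr_gt0 vi0 wv.
(* The directions come from [(1, w, w^2, ...)], [(1/v, 1, w, ...)] and [(1/v, w/v, w, ...)]. Their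
   ratios at index 1 are [w], [v], [w], and at index 2 they are [w^2], [v * w], [v * w]; this
   dictates the indices passed to [segmentI]. *)
exists (segment (powers 1 w)), (segment (prepend v^-1 (powers 1 w))),
  (segment (prepend v^-1 (scale w (prepend v^-1 (powers 1 w))))).
have arc0 x : X x -> 0 < x 0%N -> arc_endpoint R (segment x) origin.
  move=> Xx x0; exists x; apply: segment_arc => // xE.
  by move: x0; rewrite xE ltxx.
split.
- by split; exact: segment_sub.
- by split; apply: arc0 => //; rewrite /powers mul1r ltr01.
- move: wv wwv vwv; set u := v^-1 => wu wwu uwu.
  split; [apply: (@segmentI _ _ 1%N)|apply: (@segmentI _ _ 2%N)|
    apply: (@segmentI _ _ 1%N)]; rewrite /= /powers /scale /= => e; lra.
Qed.

(** If [x] were interior to an arc, the two halves of the arc would meet only at [x]. By maximality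
    neither can leave [x] outwards, so both go inwards, contradicting [disjoint_down]. *)
Lemma maximal_endpoint x : X x -> x <> origin ->
  (forall c, X (scale c x) -> c <= 1) -> endpoint R X x.
Proof.
move=> Xx x0 xmax; split=> // A AX [a [b aAb]] Ax.
have [f [g [fA fK fc gc [fa fb]]]] := aAb.
move: Ax; rewrite -fA => -[t /= t01 ft].
have [t0|tN0] := eqVneq t 0; first by exists b; rewrite -ft t0 fa fA.
have [t1|tN1] := eqVneq t 1.
  by exists a; apply: arc_sym; rewrite -ft t1 fb fA.
have /andP[t0 t1] : 0 < t < 1.
  by move: t01; rewrite in_itv /= !lt_neqAle (eq_sym 0) tN0 tN1.
have sub s u : 0 <= s -> u <= 1 -> s <= u -> ray_convex Omega (f @` `[s, u]).
  move=> s0 u1 su.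
  have su01 : `[s, u] `<=` `[(0 : R), 1].
    move=> r /= /[!in_itv] /= /andP[sr ru].
    by rewrite (le_trans s0 sr) (le_trans ru u1).
  have fsu := continuous_subspaceW su01 fc.
  apply: connected_ray_convex => //.
  - apply: compact_closed; first exact: ptws_hausdorff.
    by apply: continuous_compact fsu _; exact: segment_compact.
  - by apply: connected_continuous_connected fsu; exact: segment_connected.
  - by move=> _ [r /su01 r01 <-]; apply: AX; rewrite -fA; exists r.
have rD := sub 0 t (lexx 0) (ltW t1) (ltW t0).
have rE := sub t 1 (ltW t0) (lexx 1) (ltW t1).
have down D y : ray_convex Omega D -> D x -> D y -> y <> x ->
    exists2 c, 0 <= c < 1 & D (scale c x).
  move=> D' Dx Dy yx.
  (* An outward move would put [scale c^-1 x] in [X] with [c^-1 > 1]. *)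
  have [//|[z Dz [c /andP[c0 c1] xz]]] := ray_convex_move D' Dx Dy yx.
  have cN0 : c != 0 by apply/eqP => cE; apply: x0; rewrite xz cE scale0.
  have := xmax c^-1; rewrite xz scaleA mulVf // scale1.
  have [DX _ _] := D'.
  move=> /(_ (DX _ Dz)); rewrite invf_le1 ?lt_neqAle 1?eq_sym ?cN0 // leNgt.
  by rewrite c1.
have ends s : s \in `[0, 1] -> s != t -> f s <> x.
  move=> s01 st; rewrite -ft => /(congr1 g); rewrite !fK // => /eqP.
  by apply/negP.
have i0 : (0 : R) \in `[0, 1] by rewrite in_itv /= lexx ler01.
have i1 : (1 : R) \in `[0, 1] by rewrite in_itv /= lexx ler01.
have Dx : (f @` `[0, t]) x by exists t; rewrite //= in_itv /= lexx ltW.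
have Ex : (f @` `[t, 1]) x by exists t; rewrite //= in_itv /= lexx ltW.
have [||c c01 Dc] := down _ (f 0) rD Dx.
- by exists 0; rewrite //= in_itv /= lexx ltW.
- by apply: ends; rewrite // eq_sym.
have [||d d01 Ed] := down _ (f 1) rE Ex.
- by exists 1; rewrite //= in_itv /= lexx ltW.
- by apply: ends; rewrite // eq_sym.
exfalso; apply: (disjoint_down rD rE _ x0 c01 d01 Dc Ed).
apply/seteqP; split=> [z [[s s0t <-] [u ut1 us]]|_ ->]; last by split.
move: s0t ut1; rewrite /= !in_itv /= => /andP[s0 st] /andP[tu u1].
have : s = u.
  rewrite -(fK u) ?us ?fK // in_itv /= ?s0 ?u1 ?(le_trans _ tu) ?(ltW t0) //.
  exact: le_trans st (ltW t1).
move=> su; rewrite (_ : s = t) //; apply/eqP; rewrite eq_le st /=.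
by rewrite su.
Qed.

End Ramification.

(** * Metrizability and smoothness *)

Section Metric.
Context {R : realType} (M : nat) (Omega : M.-tuple R).
Hypothesis M_ge2 : (2 <= M)%N.
Hypothesis Omega_gt0 : forall w : R, w \in Omega -> 0 < w.
Local Notation T := {ptws nat -> R}.
Local Notation X := (mahavier_product (F_ Omega)).
Implicit Types (x y z : T) (A D E : set T).

(** The weights tend to 0, so on sequences in [[0, 1]] only finitely many coordinates matter at a
    given scale; this yields the product topology. *)
Definition sup_dist x y : R := sup (range (fun i => `|x i - y i| / i.+1%:R)).

Lemma X_dist_le1 x y i : X x -> X y -> `|x i - y i| <= 1.
Proof.
move=> Xx Xy; have := X_ge0 i Xx; have := X_ge0 i Xy.
have := X_le1 i Xx; have := X_le1 i Xy.
by rewrite ler_norml => *; apply/andP; split; lra.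
Qed.

Lemma ge_sup_dist x y e : (forall i, `|x i - y i| / i.+1%:R <= e) ->
  sup_dist x y <= e.
Proof.
move=> xye; apply: ge_sup; first by exists (`|x 0%N - y 0%N| / 1%:R), 0%N.
by move=> _ [i _ <-].
Qed.

Lemma le_sup_dist x y i : X x -> X y -> `|x i - y i| / i.+1%:R <= sup_dist x y.
Proof.
move=> Xx Xy; apply: ub_le_sup; last by exists i.
exists 1 => _ [j _ <-]; rewrite ler_pdivrMr ?ltr0Sn // mul1r.
by apply: le_trans (X_dist_le1 j Xx Xy) _; rewrite ler1n.
Qed.

Lemma sup_dist_metrizes : metrizes X sup_dist.
Proof.
split.
- move=> x y Xx Xy; apply: le_trans (le_sup_dist 0%N Xx Xy).
  by rewrite divr_ge0.
- move=> x y Xx Xy; split=> [xy0|->]; last first.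
    apply/eqP; rewrite eq_le (le_trans _ (le_sup_dist 0%N Xy Xy)) ?divr_ge0 // andbT.
    by apply: ge_sup_dist => i; rewrite subrr normr0 mul0r.
  apply/funext => i; apply/eqP; rewrite -subr_eq0 -normr_le0.
  have := le_sup_dist i Xx Xy; rewrite xy0 ler_pdivrMr ?ltr0Sn //.
  by rewrite mul0r.
- move=> x y _ _; rewrite /sup_dist; under eq_fun do rewrite distrC.
  by [].
- move=> x y z Xx Xy Xz; apply: ge_sup_dist => i.
  apply: le_trans (lerD (le_sup_dist i Xx Xy) (le_sup_dist i Xy Xz)).
  rewrite -mulrDl ler_pM2r ?invr_gt0 ?ltr0Sn //.
  exact: ler_distD.
- move=> x U Xx; split=> [xU|[e e0 eU]].
    have [n [e [e0 boxU]]] : exists n (e : R), 0 < e /\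
        forall z, (forall i, (i <= n)%N -> `|x i - z i| < e) -> (X z -> U z).
      exact: nbhs_boxP xU.
    (* The smallest weight among the coordinates up to [n] is [1/(n+1)]. *)
    exists (e / n.+1%:R); first by rewrite divr_gt0 ?ltr0Sn.
    move=> y Xy xy; apply: (boxU y _ Xy) => i ilen.
    have := le_lt_trans (le_sup_dist i Xx Xy) xy.
    rewrite ltr_pdivrMr ?ltr0Sn // => /lt_le_trans; apply.
    by rewrite -mulrA ler_piMr ?(ltW e0) // ler_pdivrMl ?ltr0Sn // mulr1 ler_nat ltnS.
  have [n ne] : exists n, n.+1%:R^-1 < e.
    have [N _ /(_ N (leqnn N)) Ne] := near_infty_natSinv_lt (PosNum e0).
    by exists N.
  have e20 : 0 < e / 2 by lra.
  have xe := nbhs_box x n e20.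
  change (nbhs x [set y | X y -> U y]).
  apply: filterS xe => y /= xy Xy; apply: eU => //.
  (* The coordinates up to [n] are controlled by [e / 2], the later ones by their weight. A bound
     strictly below [e] is needed because a supremum preserves only weak inequalities. *)
  have m_lt : Num.max (e / 2) n.+1%:R^-1 < e by rewrite gt_max ne; lra.
  apply: le_lt_trans m_lt; apply: ge_sup_dist => i; rewrite le_max.
  have [ilen|nlti] := leqP i n; apply/orP; [left|right].
    rewrite ler_pdivrMr ?ltr0Sn //; apply: le_trans (ltW (xy _ ilen)) _.
    by rewrite ler_peMr ?(ltW e20) // ler1n.
  rewrite ler_pdivrMr ?ltr0Sn //; apply: le_trans (X_dist_le1 i Xx Xy) _.
  by rewrite ler_pdivlMl ?ltr0Sn // mulr1 ler_nat ltnS ltnW.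
Qed.

Lemma X_continuum : continuum R X.
Proof.
split; first by exists origin; exact: X_origin.
- exact: X_compact.
- apply: (@ray_convex_connected _ _ Omega).
  split=> [//|x a b Xx _ /andP[a0 ab] b1|x y _ _ X0].
    by apply: X_shrink => //; rewrite (le_trans a0 ab).
  by case: X0; exact: X_origin.
- by exists sup_dist; exact: sup_dist_metrizes.
Qed.

(** Scaling is jointly continuous, and compactness of [[0, 1]] makes the estimate uniform in [c]. *)
Lemma segment_uniform (d : T -> T -> R) x e : metrizes X d -> X x -> 0 < e ->
  nbhs x [set z | X z ->
    forall c, 0 <= c <= 1 -> d (scale c z) (scale c x) < e].
Proof.
move=> [_ _ dC dD dnbhs] Xx e0; have e20 : 0 < e / 2 by lra.
have /compact_near_coveringP/near_covering_withinP cover :=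
  @segment_compact R 0 1.
have H : \forall z \near x, `[(0 : R), 1] `<=`
    (fun c => X z -> d (scale c z) (scale c x) < e).
  apply: (cover T (nbhs x) (fun z c => X z -> d (scale c z) (scale c x) < e)).
  move=> c /= /[!in_itv] /= c01.
  have Xcx := X_shrink Xx c01.
  pose B : set T := [set y | X y -> d (scale c x) y < e / 2].
  have nB : nbhs (scale c x) B.
    have [_ h] := dnbhs _ [set y | d (scale c x) y < e / 2] Xcx.
    by apply: h; exists (e / 2).
  have nBx : nbhs c [set u | B (scale u x)] := @ray_continuous R x c B nB.
  have [[P Q] /= [Pc Qx] PQ] : filter_prod (nbhs c) (nbhs x)
    [set p : R * T | B (scale p.1 p.2)] := @scaling_continuous R (c, x) B nB.
  (* For these [u] and [z], both [scale u z] and [scale u x] are within [e / 2] of [scale c x]. *)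
  exists (P `&` [set u | B (scale u x)], Q); first by split=> //; exact: filterI.
  move=> [u z] /= [[Pu Bux] Qz] /[!in_itv] /= u01 Xz.
  have Buz : B (scale u z) by exact: (PQ (u, z)).
  have Xux := X_shrink Xx u01; have Xuz := X_shrink Xz u01.
  have := dD _ _ _ Xuz Xcx Xux; have := Bux Xux; have := Buz Xuz.
  rewrite (dC _ _ Xuz Xcx); lra.
apply: filterS H => z /= zP Xz c c01; exact: zP.
Qed.

(** Matching points with equal parameters shows that [e] belongs to the set whose infimum is the
    distance. *)
Lemma hausdorff_segment (d : T -> T -> R) x z e : metrizes X d -> X x -> X z ->
  0 < e -> (forall c, 0 <= c <= 1 -> d (scale c z) (scale c x) < e) ->
  `|hausdorff_dist d (segment z) (segment x)| <= e.
Proof.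
move=> [_ _ dC _ _] Xx Xz e0 dzx.
rewrite /hausdorff_dist; set S := [set r : R | _].
have Se : S e.
  split=> // _ [c /= c01 <-].
    by exists (scale c x); [exists c|apply: dzx; move: c01; rewrite in_itv].
  have c01' : 0 <= c <= 1 by move: c01; rewrite in_itv.
  exists (scale c z); first by exists c.
  by rewrite dC; [exact: dzx|exact: X_shrink|exact: X_shrink].
have S0 : lbound S 0 by move=> r [/ltW].
rewrite ger0_norm; last by apply: lb_le_inf => //; exists e.
by apply: ge_inf => //; exists 0.
Qed.

Lemma X_smooth : smooth_at R X origin.
Proof.
move=> d dX x_ x Xx_ Xx x_x A_ A A_P AP.
(* The degenerate arc fits too: the segment of the origin is the origin alone. *)
have seg B y : X y -> B `<=` X /\ arc_or_point R B origin y -> B = segment y.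
  move=> Xy [BX [[<- ->]|]]; last exact: arc_segment.
  apply/seteqP; split=> [_ ->|_ [c _ <-]]; last by rewrite scaler_origin.
  by exists 0; rewrite ?scale0 //= in_itv /= lexx ler01.
rewrite (seg _ _ Xx AP); have -> : A_ = fun n => segment (x_ n).
  by apply/funext => n; exact: seg (A_P n).
apply/cvgrPdist_le => e e0; near=> n.
rewrite sub0r normrN; apply: hausdorff_segment => //.
move: (Xx_ n); near: n.
exact: (x_x _ (segment_uniform dX Xx e0)).
Unshelve. all: by end_near. Qed.

End Metric.

(** * Density of the endpoints *)

Section Density.
Context {R : realType} (r rho : R).
Hypothesis nc : never_connect r rho.

Let r0 : 0 < r. Proof. by case: nc. Qed.
Let r1 : r < 1. Proof. by case: nc. Qed.
Let rho1 : 1 < rho. Proof. by case: nc. Qed.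
Let rho0 : 0 < rho. Proof. exact: lt_trans rho1. Qed.

(** Exponents are natural numbers because a sequence is continued only by multiplying by members of
    [Omega]. *)
Definition monomial : set R := [set g | exists a b : nat, g = r ^+ a * rho ^+ b].

Lemma monomial_gt0 g : monomial g -> 0 < g.
Proof. by move=> [a [b ->]]; rewrite mulr_gt0 ?exprn_gt0. Qed.

Lemma monomialM g h : monomial g -> monomial h -> monomial (g * h).
Proof.
move=> [a [b ->]] [c [d ->]]; exists (a + c)%N, (b + d)%N.
by rewrite !exprD; ring.
Qed.

Lemma monomial_eq1 a b : r ^+ a * rho ^+ b = 1 -> b = 0%N.
Proof.
have [_ _ _ /(_ a (- b%:Z))[+ _]] := nc; move=> H rab.
have rhob : rho ^+ b != 0 by exact/lt0r_neq0/exprn_gt0.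
have : r ^+ a = rho ^ (- b%:Z).
  by rewrite -invr_expz -exprnP; apply: (mulIf rhob); rewrite rab mulVf.
by rewrite exprnP => /H[_ /eqP]; rewrite oppr_eq0 => /eqP[].
Qed.

(** A product equal to 1 contains no factor [rho], so [h] would be a power of [r] and could not
    exceed 1. *)
Lemma monomialM_neq1 g h : monomial g -> monomial h -> 1 < h -> g * h <> 1.
Proof.
move=> [a [b ->]] [c [d ->]] h1 gh.
have : r ^+ (a + c) * rho ^+ (b + d) = 1 by rewrite -gh !exprD; ring.
move=> /monomial_eq1/eqP; rewrite addn_eq0 => /andP[_ /eqP d0].
by move: h1; rewrite d0 expr0 mulr1 ltNge exprn_ile1 // ltW.
Qed.

(* If [beta := sup {g < 1} < 1], multiplying by some [h > 1] close enough to
   [alpha := inf {h > 1}] maps [{g < 1}] into itself, so that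
   [beta * h <= beta]. *)
Lemma monomial_near1 e : 0 < e -> exists g, [/\ monomial g, 1 - e < g & g < 1].
Proof.
move=> e0.
pose lo : set R := [set g | monomial g /\ g < 1].
pose up : set R := [set h | monomial h /\ 1 < h].
have lor : lo r by split=> //; exists 1%N, 0%N; rewrite expr1 expr0 mulr1.
have uprho : up rho by split=> //; exists 0%N, 1%N; rewrite expr1 expr0 mul1r.
have lo_sup : has_sup lo by split; [exists r|exists 1 => g [_ /ltW]].
have up_inf : has_inf up by split; [exists rho|exists 1 => h [_ /ltW]].
have beta_ub g : lo g -> g <= sup lo by exact: sup_upper_bound.
have alpha_lb h : up h -> inf up <= h by apply: ge_inf; case: up_inf.
have beta0 : 0 < sup lo := lt_le_trans r0 (beta_ub _ lor).
have alpha1 : 1 <= inf up by apply: lb_le_inf; [exists rho|move=> h [_ /ltW]].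
suff beta1 : 1 <= sup lo.
  have [g [mg g1] ge] := sup_adherent e0 lo_sup.
  by exists g; split=> //; apply: le_lt_trans ge; rewrite lerD2r.
rewrite leNgt; apply/negP => beta1.
(* The margin is chosen so that the resulting [h] satisfies [h * sup lo < inf up]. *)
have eps0 : 0 < inf up / sup lo - inf up.
  by rewrite subr_gt0 ltr_pdivlMr // gtr_pMr // (lt_le_trans ltr01).
have [h [mh h1]] := inf_adherent eps0 up_inf.
rewrite addrC subrK ltr_pdivlMr // => hb.
have h0 : 0 < h := lt_trans ltr01 h1.
have : sup lo <= sup lo / h.
  apply: ge_sup; first by exists r.
  move=> g [mg g1]; rewrite ler_pdivlMr //; apply: (beta_ub).
  split; first exact: monomialM.
  rewrite lt_neqAle; apply/andP; split; first exact/eqP/monomialM_neq1.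
  (* Otherwise [g * h] would be a member of [up] below [inf up]. *)
  rewrite leNgt; apply/negP => gh1.
  have := alpha_lb (g * h) (conj (monomialM mg mh) gh1).
  rewrite leNgt (le_lt_trans _ hb) // mulrC ler_pM2l //; exact: beta_ub.
by rewrite ler_pdivlMr // leNgt ltr_pMr // h1.
Qed.

Lemma exprn_small (g e : R) : 0 < g < 1 -> 0 < e -> exists n, g ^+ n < e.
Proof.
move=> /andP[g0 g1] e0.
have : (GRing.exp g : R^nat) @ \oo --> (0 : R).
  by apply: cvg_expr; rewrite ger0_norm // ltW.
move=> /cvgrPdist_lt /(_ _ e0)[N _ /(_ N (leqnn N))] /=.
by rewrite sub0r normrN ger0_norm ?exprn_ge0 ?(ltW g0) // => ?; exists N.
Qed.

(** Powers of [rho] first push [u] above 1. Powers of a monomial [g] with [s < g < 1] then bring it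
    back: the last value above 1, multiplied by [g], still exceeds [s]. *)
Lemma monomial_approx (u s : R) : 0 < u <= 1 -> s < 1 ->
  exists a b : nat, s < u * r ^+ a * rho ^+ b <= 1.
Proof.
move=> /andP[u0 u1] s1.
have s10 : 0 < 1 - s by rewrite subr_gt0.
have [g [[a [b gE]] sg g1]] := monomial_near1 s10.
have mg : monomial g by exists a, b.
have g0 := monomial_gt0 mg.
have [B uB] : exists B, 1 < u * rho ^+ B.
  have [|B] := @exprn_small rho^-1 u _ u0.
    by rewrite invr_gt0 rho0 invf_lt1.
  rewrite exprVn invf_plt ?posrE ?exprn_gt0 // -[u^-1]mul1r ltr_pdivrMr // mulrC.
  by exists B.
have ex_k : exists k, u * rho ^+ B * g ^+ k <= 1.
  have [||k gk] := @exprn_small g (u * rho ^+ B)^-1.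
  - by rewrite g0.
  - by rewrite invr_gt0 (lt_trans ltr01).
  by exists k; rewrite mulrC -ler_pdivlMr ?(lt_trans ltr01) // mul1r ltW.
case: (ex_minnP ex_k) => -[|k] k1 kmin.
  by move: k1; rewrite expr0 mulr1 leNgt uB.
exists (a * k.+1)%N, (B + b * k.+1)%N.
have -> : u * r ^+ (a * k.+1) * rho ^+ (B + b * k.+1) = u * rho ^+ B * g ^+ k.+1.
  by rewrite gE exprMn -!exprM exprD; ring.
rewrite k1 andbT; apply: lt_trans (_ : s < g) _; first by move: sg; rewrite subKr.
rewrite exprSr mulrA ltr_pMl // ltNge; apply/negP => /kmin.
by rewrite ltnn.
Qed.

End Density.

(** * Continuing finite initial pieces to endpoints *)

Section LelekFan.
Context {R : realType} (M : nat) (Omega : M.-tuple R) (r rho : R).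
Hypothesis M_ge2 : (2 <= M)%N.
Hypothesis Omega_gt0 : forall w : R, w \in Omega -> 0 < w.
Hypotheses (Or : r \in Omega) (Orho : rho \in Omega).
Hypothesis nc : never_connect r rho.
Local Notation T := {ptws nat -> R}.
Local Notation X := (mahavier_product (F_ Omega)).
Implicit Types (x y z : T).

Definition reaches (c v : R) := exists z k, [/\ X z, z 0%N = c & z k = v].

Lemma reaches_refl v : 0 <= v <= 1 -> reaches v v.
Proof.
move=> v01; have [_ /ltW r1 _ _] := nc; exists (powers v r), 0%N.
by split; [exact: X_powers|rewrite /powers mulr1|rewrite /powers mulr1].
Qed.

Lemma reaches_step c v w : w \in Omega -> 0 <= c <= 1 -> reaches (w * c) v ->
  reaches c v.
Proof.
move=> wO c01 [z [k [Xz z0 zk]]]; exists (prepend c z), k.+1.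
by split=> //; exact: X_prepend Xz c01 wO z0.
Qed.

Lemma reaches_down c v a : 0 <= c <= 1 -> reaches (c * r ^+ a) v -> reaches c v.
Proof.
have [/ltW r0 /ltW r1 _ _] := nc.
elim: a c => [|a IHa] c c01; first by rewrite expr0 mulr1.
rewrite exprS mulrCA mulrA => /IHa rc; apply: (reaches_step Or c01 (rc _)).
by case/andP: c01 => c0 c1; rewrite mulr_ge0 //= mulr_ile1.
Qed.

(** The intermediate values increase, so bounding the last one by 1 keeps them all in [[0, 1]]. *)
Lemma reaches_up c v b : 0 <= c -> c * rho ^+ b <= 1 ->
  reaches (c * rho ^+ b) v -> reaches c v.
Proof.
have [_ _ rho1 _] := nc; have rho0 : 0 < rho by exact: lt_trans rho1.
elim: b c => [|b IHb] c c0; first by rewrite expr0 mulr1.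
rewrite exprS mulrCA mulrA => cb1 /IHb rc; apply: (reaches_step Orho).
  rewrite c0 /=; apply: le_trans cb1; rewrite -mulrA mulrCA ler_peMr //.
  by rewrite -exprS exprn_ege1 // ltW.
by apply: rc => //; rewrite mulr_ge0 // ltW.
Qed.

(** The induction drops the first coordinate, continues the shifted sequence and puts the coordinate
    back. *)
Lemma X_follow x n v : X x -> reaches (x n) v ->
  exists z k, [/\ X z, forall i, (i <= n)%N -> z i = x i & z k = v].
Proof.
elim: n x => [|n IHn] x Xx xv.
  have [z [k [Xz z0 zk]]] := xv; exists z, k; split=> // i.
  by rewrite leqn0 => /eqP ->.
have Xs : X (fun i => x i.+1 : R).
  by move/XP: Xx => [x01 xM]; apply/XP; split=> i; [exact: x01|exact: xM].
have [z [k [Xz zx zk]]] := IHn _ Xs xv.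
have /XP[x01 /(_ 0%N)[w wO x1]] := Xx.
exists (prepend (x 0%N) z), k.+1; split=> //.
  by apply: (X_prepend Xz (x01 0%N) wO); rewrite zx.
by move=> [|i] //= ilen; exact: zx.
Qed.

Lemma near_endpoint x n (e : R) : X x -> x <> origin -> 0 < e ->
  exists2 z, endpoint R X z & forall i, (i <= n)%N -> `|x i - z i| < e.
Proof.
move=> Xx xN0 e0.
have x0 := X_gt0 Xx xN0; have xn0 := X_gt0P Omega_gt0 n Xx x0.
(* With the supremum [m] of the continuation in [((1 + e)^-1, 1]], rescaling by [m^-1] multiplies
   coordinates that are at most 1 by less than [1 + e], so moves them by less than [e]. *)
have [a [b]] : exists a b : nat, (1 + e)^-1 < x n * r ^+ a * rho ^+ b <= 1.
  apply: monomial_approx => //; first by rewrite xn0 (X_le1 n Xx).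
  by rewrite invf_lt1 ?ltrDl // addr_gt0.
set v := _ * rho ^+ b => /andP[ev v1].
have [r0 /ltW r1 rho1 _] := nc; have rho0 : 0 < rho by exact: lt_trans rho1.
have v0 : 0 <= v by rewrite !mulr_ge0 ?exprn_ge0 // ltW.
have xnv : reaches (x n) v.
  (* All factors [r] come before the factors [rho]: the descent stays below 1, and the ascent is
     bounded by its final value [v]. *)
  apply: (@reaches_down _ _ a); first by rewrite ltW //= (X_le1 n Xx).
  apply: (@reaches_up _ _ b) => //; first by rewrite mulr_ge0 ?exprn_ge0 // ltW.
  by apply: reaches_refl; rewrite v0.
have [z [k [Xz zx zk]]] := X_follow Xx xnv.
pose m := sup (range (z : nat -> R)).
have z_ub : has_ubound (range (z : nat -> R)).
  by exists 1 => _ [i _ <-]; exact: X_le1.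
have zm i : z i <= m by apply: ub_le_sup => //; exists i.
have m1 : m <= 1.
  by apply: ge_sup; [exists (z 0%N), 0%N|move=> _ [i _ <-]; exact: X_le1].
have em : (1 + e)^-1 < m by apply: lt_le_trans ev _; rewrite -zk.
have m0 : 0 < m by apply: lt_trans em; rewrite invr_gt0; lra.
have Xmz : X (scale m^-1 z).
  apply: X_scale => // [|i]; first by rewrite invr_ge0 ltW.
  by rewrite mulrC ler_pdivrMr // mul1r.
exists (scale m^-1 z).
  apply: maximal_endpoint => //.
    move=> /(congr1 (fun u : T => u 0%N)); rewrite /scale /origin zx //.
    by apply/eqP; rewrite mulf_neq0 ?invr_eq0 // lt0r_neq0.
  (* A factor [c > 1] would make [m / c] an upper bound of [z], below its supremum [m]. *)
  move=> c; rewrite scaleA => Xcz; rewrite leNgt; apply/negP => c1.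
  have c0 : 0 < c by exact: lt_trans c1.
  have : m <= m / c.
    apply: ge_sup; first by exists (z 0%N), 0%N.
    move=> _ [i _ <-]; rewrite ler_pdivlMr //.
    have := X_le1 i Xcz; rewrite /scale mulrAC ler_pdivrMr // mul1r.
    by rewrite mulrC.
  by rewrite ler_pdivlMr // leNgt ltr_pMr // c1.
move=> i ilen; rewrite /scale zx //.
have mV : 1 <= m^-1 by rewrite invf_ge1.
have mVe : m^-1 < 1 + e by rewrite invf_plt ?posrE //; lra.
have xi0 := X_ge0 i Xx; have xi1 := X_le1 i Xx.
rewrite ltr_norml; apply/andP; split; nra.
Qed.

Lemma endpoints_dense : X `<=` closure (endpoint R X).
Proof.
have H x : X x -> x <> origin -> closure (endpoint R X) x.
  move=> Xx xN0 B /nbhs_boxP[n [e [e0 boxB]]].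
  have [z Ez zx] := near_endpoint n Xx xN0 e0.
  by exists z; split=> //; exact: boxB.
move=> x Xx; have [->|/eqP] := eqVneq x origin; last exact: H.
(* Passing to the interior makes [B] a neighbourhood of the nearby nonzero point [powers c r], to
   which the first case applies. *)
move=> B /nbhs_interior /nbhs_boxP[n [e [e0 boxB]]].
have [r0 /ltW r1 _ _] := nc.
pose c := Num.min (e / 2) 1.
have c0 : 0 < c by rewrite lt_min ltr01 andbT; lra.
have c1 : c <= 1 by rewrite ge_min lexx orbT.
have ce : c < e by rewrite gt_min; apply/orP; left; lra.
have Xy : X (powers c r) by apply: X_powers; rewrite // (ltW c0).
apply: (H _ Xy).
  move=> /(congr1 (fun u : T => u 0%N)); rewrite /powers /origin mulr1.
  by apply/eqP; rewrite lt0r_neq0.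
apply: boxB => i _; rewrite /origin sub0r normrN ger0_norm; last exact: X_ge0 Xy.
by apply: le_lt_trans ce; rewrite /powers ler_piMr ?(ltW c0) // exprn_ile1 // ltW.
Qed.

Lemma X_Lelek_fan : Lelek_fan R X.
Proof.
split; last exact: endpoints_dense.
have [_ r1 rho1 _] := nc.
exists origin; split; last exact: X_smooth.
split.
- exact: X_continuum.
- exact: X_arcwise_connected.
- exact: X_hereditarily_unicoherent.
- split; first exact: origin_ramification r1 rho1.
  by move=> x /(ramification_origin)->.
Qed.

End LelekFan.

Theorem theorem4p11 (R : realType) (M : nat) (Omega : M.-tuple R) :
  LF_inducing Omega -> Lelek_fan R (mahavier_product (F_ Omega)).
Proof.
move=> [M2 Omega_gt0 _ nc].
(* As [M >= 2], the first two entries are genuine members of the tuple and not default values of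
   [nth]. *)
apply: (X_Lelek_fan M2 Omega_gt0 _ _ nc); apply: mem_nth; rewrite size_tuple //.
exact: ltnW.
Qed.
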